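(* Suppose that the covering graph of $(S, \preceq)$ is a rooted tree with root $e$. (i) Let $\boldsymbol{Y}$ be a downward run chain on $S$ with transition function $Q$ and standard invariant function $G(x) = \mathbb{P}_e(U_x \le U_e)$. Then $G$ is the upper probability function of $Y_1$ given $Y_0 = e$: $G(x) = \sum_{y \succeq x} Q(e,y) = \mathbb{P}_e(Y_1 \succeq x)$ for $x \in S$. Moreover $\mathbb{E}_e(U_e) = 1 + \mathbb{E}_e[d(e,Y_1)]$. If the chain is positive recurrent, the invariant probability density function equals the probability density function of $Y_1$ given $Y_0 = e$ if and only if the invariant distribution has constant rate. (ii) Conversely, if $G$ is the upper probability function of a distribution with support $S$ and probability density function $g$, then $Q(e,x) = g(x)$ for $x \in S$ and $Q(x,x^-) = 1$ for $x \in S - \{e\}$ defines the transition function of a downward run chain on $S$ with $G$ as its standard invariant function.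
   Context: $(S, \preceq)$ is a discrete (countable) partially ordered set with a minimum element $e$, such that for every $x \in S$ every chain (totally ordered subset) in $S$ from $e$ to $x$ is finite. An element $y$ covers $x$ if $y$ is a minimal element of $\{t \in S : t \succ x\}$; $B_x = \{w \in S : x \text{ covers } w\}$. The covering graph is the directed graph on $S$ with an edge $(x,y)$ whenever $y$ covers $x$. When it is a rooted tree with root $e$, $B_x$ has a single element $x^-$ for each $x \ne e$, and $d(e,x)$ is the length of the unique path from $e$ to $x$. A downward run chain is a (time-homogeneous, discrete-time) Markov chain $(Y_0, Y_1, \ldots)$ on $S$ whose transition function $Q$ satisfies $Q(x,y) > 0$ if and only if either $x = e$ and $y \in S$, or $x \in S - \{e\}$ and $y \in B_x$. $\mathbb{P}_e$, $\mathbb{E}_e$ denote probability and expectation given $Y_0 = e$, and $U_x = \min\{n \ge 1 : Y_n = x\}$. For a random variable $Z$ with support $S$ (every point of $S$ has positive probability), the probability density function is $x \mapsto \mathbb{P}(Z = x)$, the upper probability function is $x \mapsto \mathbb{P}(Z \succeq x)$, and the rate function is $r(x) = \mathbb{P}(Z=x)/\mathbb{P}(Z \succeq x)$; the distribution has constant rate if $r$ is constant on $S$. *)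

(* Defs.v *)
From mathcomp Require Import all_boot all_order all_algebra.
From mathcomp Require Import all_classical all_reals all_analysis.

Set Implicit Arguments.
Unset Strict Implicit.
Unset Printing Implicit Defensive.

Import Order.TTheory GRing.Theory Num.Theory.

Local Open Scope classical_set_scope.
Local Open Scope ring_scope.

Section CoveringGraph.
Context {disp : Order.disp_t} {S : porderType disp}.

Definition minimal_in (A : set S) (y : S) : Prop :=
  A y /\ forall t, A t -> (t <= y)%O -> t = y.

(* [covers y x] reads: y covers x. *)
Definition covers (y x : S) : Prop := minimal_in [set t | (x < t)%O] y.

(* The set B_x. *)
Definition lower_covers (x : S) : set S := [set w | covers x w].

Definition locally_finite_from (e : S) : Prop :=
  forall (x : S) (C : set S),
    total_on C (fun s t => (s <= t)%O) ->
    C e -> C x -> (forall t, C t -> (e <= t <= x)%O) ->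
    finite_set C.

Definition covering_edge : rel S := fun x y => `[< covers y x >].

(* Directed paths of the covering graph from x to y; the starting vertex is not
   listed, so that [size p] is the number of edges. *)
Definition covering_paths (x y : S) : set (seq S) :=
  [set p | path covering_edge x p /\ last x p = y].

(* The covering graph is a directed graph whose edges point away from e, so it
   is a rooted tree when each vertex is reached from e by exactly one path. *)
Definition is_rooted_tree (e : S) : Prop :=
  forall x : S, exists! p : seq S, covering_paths e x p.

(* d(e, x). The default value of [xget] is irrelevant in a rooted tree. *)
Definition tree_dist (e x : S) : nat := size (xget [::] (covering_paths e x)).

(* x^-. The default value of [xget] is irrelevant in a rooted tree if x != e. *)
Definition parent (x : S) : S := xget x (lower_covers x).

End CoveringGraph.

Section Distributions.
Context {R : realType} {disp : Order.disp_t} {S : porderType disp}.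

Definition is_pdf (f : S -> R) : Prop :=
  (forall x, 0 <= f x) /\ \esum_(x in [set: S]) (f x)%:E = 1%E.

Definition full_support (f : S -> R) : Prop := forall x, 0 < f x.

Definition upper_prob (f : S -> R) (x : S) : \bar R :=
  \esum_(y in [set y | (x <= y)%O]) (f y)%:E.

Definition rate (f : S -> R) (x : S) : R := f x / fine (upper_prob f x).

Definition constant_rate (f : S -> R) : Prop :=
  exists alpha : R, forall x, rate f x = alpha.

Definition is_transition (Q : S -> S -> R) : Prop := forall x, is_pdf (Q x).

Definition downward_run (e : S) (Q : S -> S -> R) : Prop :=
  is_transition Q /\
  forall x y, 0 < Q x y <-> x = e \/ (x <> e /\ lower_covers x y).

Definition invariant_pdf (Q : S -> S -> R) (f : S -> R) : Prop :=
  is_pdf f /\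
  forall y, \esum_(x in [set: S]) (f x * Q x y)%:E = (f y)%:E.

Definition run_transition (e : S) (g : S -> R) (x y : S) : R :=
  if x == e then g y else if y == parent x then 1 else 0.

End Distributions.

Section MarkovChains.
Context {R : realType} {disp : Order.disp_t} {S : porderType disp}.
Context {d : measure_display} {Omega : measurableType d}.

(* Under the law P x, the process Y is the Markov chain with transition function
   Q started at x. Measurability is with respect to the discrete sigma-algebra
   of the countable set S, and the Markov property is written with the
   conditional probability multiplied out, so that nothing is required after
   histories of probability zero. *)
Definition markov_chain (Q : S -> S -> R) (P : S -> probability Omega R)
    (Y : nat -> Omega -> S) : Prop :=
  [/\ forall n x, measurable (Y n @^-1` [set x]),
      forall x, P x [set w | Y 0%N w = x] = 1%E &
      forall x n (s : nat -> S),
        P x [set w | forall i, (i <= n.+1)%N -> Y i w = s i] =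
        (P x [set w | forall i, (i <= n)%N -> Y i w = s i] *
         (Q (s n) (s n.+1))%:E)%E].

(* U_x = min {n >= 1 : Y_n = x}, equal to +oo if there is no such n. *)
Definition hitting_time (Y : nat -> Omega -> S) (x : S) (w : Omega) : \bar R :=
  ereal_inf [set n%:R%:E | n in [set n : nat | (1 <= n)%N /\ Y n w = x]].

Definition std_invariant (P : S -> probability Omega R)
    (Y : nat -> Omega -> S) (e x : S) : \bar R :=
  P e [set w | (hitting_time Y x w <= hitting_time Y e w)%E].

Definition expected_hitting (P : S -> probability Omega R)
    (Y : nat -> Omega -> S) (x y : S) : \bar R :=
  (\int[P x]_w hitting_time Y y w)%E.

Definition positive_recurrent (P : S -> probability Omega R)
    (Y : nat -> Omega -> S) : Prop :=
  forall x, (expected_hitting P Y x x < +oo)%E.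

End MarkovChains.

(* Main.v *)
From HB Require Import structures.
Require Import Defs.
From mathcomp Require Import all_boot all_order all_algebra.
From mathcomp Require Import all_classical all_reals all_analysis.
From mathcomp Require Import measurable_realfun zify lra.

Set Implicit Arguments.
Unset Strict Implicit.
Unset Printing Implicit Defensive.

Import Order.TTheory GRing.Theory Num.Theory.

Local Open Scope classical_set_scope.
Local Open Scope ring_scope.

(** In a rooted covering tree the elements below [y] are exactly the vertices of
    the path from the root to [y] ([le_parent]). A downward run chain leaves [e]
    for a random [Y 1] and then moves deterministically from each element to its
    parent, so almost surely it returns to [e] at time [1 + tree_dist e (Y 1)]
    and the elements it meets on the way are exactly those below [Y 1]
    ([descends_visits]). Hence [x] is hit no later than [e] if and only if
    [x <= Y 1], which identifies the standard invariant function with the upper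
    probability function of [Y 1] and gives the mean return time.

    For the invariant densities, summing the invariance equation of [f] over
    the up-set of [y] makes the contributions of the elements strictly above [y]
    appear on both sides; cancelling them leaves
    [f y = f e * upper_prob (Q e) y] ([invariant_pdfE]), whence uniqueness.
    Existence needs [upper_prob (Q e)] to have a finite total, which is bounded
    by the mean return time because [Y 1] has [1 + tree_dist e (Y 1)] elements
    below it ([sum_upper_prob_le]). The invariance of this function, and the
    recovery of a density of constant rate from its upper probability, both rest
    on the recursion [upper_prob_cover]: an up-set is its least element together
    with the disjoint up-sets of the elements covering it.

    For the converse, a Markov chain with a prescribed transition function on a
    countable space is read off one uniform number: the unit interval is cut
    into slots of lengths [Q x y], the slot containing the number decides the
    next state, and the slot is then rescaled to the unit interval. A finite
    history thereby corresponds to an interval whose length is the product of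
    its transition probabilities ([walk_history]). *)

(** * Countable state spaces *)

Section Countable.
Context {S : choiceType}.

Lemma countable_decode (e : S) : countable [set: S] ->
  exists code : S -> nat, exists decode : nat -> S,
  cancel code decode.
Proof.
move=> /countable_injP[code code_inj].
exists code, (fun k => xget e [set x | code x = k]) => x.
by apply: code_inj; rewrite ?inE//;
  exact: (@xgetI _ e [set y | code y = code x] x erefl).
Qed.

(** The finite histories are countable in number; they are listed as
    trajectories so that no dependence on their lengths appears. *)
Lemma countable_histories (e : S) : countable [set: S] ->
  exists hist : nat -> nat -> S,
  forall (s : nat -> S) n, exists k, forall i, (i <= n)%N -> hist k i = s i.
Proof.
move=> /(countable_decode e)[code [decode codeK]].
exists (fun k i => decode (nth 0%N (odflt [::] (unpickle k)) i)) => s n.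
exists (pickle [seq code (s i) | i <- iota 0 n.+1]) => i lein.
rewrite pickleK -[odflt _ _]/[seq code (s j) | j <- iota 0 n.+1].
rewrite (nth_map 0%N) ?size_iota//.
by rewrite nth_iota// add0n codeK.
Qed.

End Countable.

(** * Sums over sets and densities *)

Section Summation.
Context {R : realType}.

Lemma esum_disjoint_union (T1 T2 : choiceType) (I : set T1)
    (J : T1 -> set T2) (a : T2 -> \bar R) :
  (forall i i' j, I i -> I i' -> J i j -> J i' j -> i = i') ->
  (forall j, 0 <= a j)%E ->
  \esum_(j in \bigcup_(i in I) J i) a j =
  \esum_(i in I) \esum_(j in J i) a j.
Proof.
move=> J_disj a_ge0; rewrite esum_esum//.
apply: (reindex_esum _ _ (fun k : T1 * T2 => k.2)); split.
- by move=> [i j] [/= Ii Jij]; exists i.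
- move=> [i j] [i' j']; rewrite !inE/= => -[Ii Jij] [Ii' Ji'j'] jj'.
  by move: Ji'j'; rewrite -jj' => /(J_disj _ _ _ Ii Ii' Jij) ->.
- by move=> j [i Ii Jij]; exists (i, j).
Qed.

Lemma ge0_esumZl (T : choiceType) (A : set T) (c : R) (a : T -> \bar R) :
  0 <= c -> (forall i, 0 <= a i)%E ->
  \esum_(i in A) (c%:E * a i)%E = (c%:E * \esum_(i in A) a i)%E.
Proof.
have le_scale (k : R) (b : T -> \bar R) : 0 <= k -> (forall i, 0 <= b i)%E ->
    (\esum_(i in A) (k%:E * b i)%E <= k%:E * \esum_(i in A) b i)%E.
  move=> k0 b0; apply: ge_ereal_sup => _ [X [finX XA] <-].
  rewrite -ge0_mule_fsumr//; apply: lee_wpmul2l; first by rewrite lee_fin.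
  by apply: esum_ge; exists X.
rewrite le_eqVlt => /orP[/eqP <- _|c0 a0].
  by rewrite mul0e esum1// => i _; rewrite mul0e.
apply/eqP; rewrite eq_le le_scale ?(ltW c0)//=.
rewrite muleC -lee_pdivlMr// muleC.
apply: le_trans (le_scale c^-1 _ _ _); last 2 first.
- by rewrite invr_ge0 ltW.
- by move=> i; rewrite mule_ge0 ?lee_fin ?(ltW c0).
apply: le_esum => i _; rewrite muleA -EFinM mulVf ?gt_eqF// mul1e//.
Qed.

Lemma subset_esum (T : choiceType) (A B : set T) (a : T -> \bar R) :
  A `<=` B -> (forall i, 0 <= a i)%E ->
  (\esum_(i in A) a i <= \esum_(i in B) a i)%E.
Proof.
move=> AB a0; rewrite [leRHS](esumID A)// (setIidr AB) leeDl//.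
exact: esum_ge0.
Qed.

Context {disp : Order.disp_t} {S : porderType disp}.

Lemma esum_pdf_fin_num (f : S -> R) (A : set S) : is_pdf f ->
  \esum_(x in A) (f x)%:E \is a fin_num.
Proof.
move=> [f0 f1]; rewrite ge0_fin_numE; last first.
  by apply: esum_ge0 => x _; rewrite lee_fin.
apply: le_lt_trans (subset_esum (@subsetT _ A) _) _ => [x|].
  by rewrite lee_fin.
by rewrite f1 ltry.
Qed.

End Summation.

(** * The order of a rooted covering tree *)

Section RootedTree.
Context {disp : Order.disp_t} {S : porderType disp} (e : S).
Hypothesis e_min : forall x : S, (e <= x)%O.
Hypothesis S_chains : locally_finite_from e.
Hypothesis S_tree : is_rooted_tree e.

(** Local finiteness speaks of sets that are chains containing [e]; here it is
    brought to the form used for sequences. *)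
Lemma no_infinite_chain (y : S) (f : nat -> S) : injective f ->
  (forall n m, (f n <= f m)%O \/ (f m <= f n)%O) -> (forall n, (f n <= y)%O) ->
  False.
Proof.
move=> f_inj f_tot f_le.
have ftot : total_on (e |` (y |` range f)) (fun s t => (s <= t)%O).
  move=> s t [->|[->|[n _ <-]]] [->|[->|[m _ <-]]]; rewrite ?lexx ?e_min ?f_le;
    do 1?[by left|by right]; exact: f_tot.
have := S_chains ftot (or_introl erefl) (or_intror (or_introl erefl)).
have bnd t : (e |` (y |` range f)) t -> (e <= t <= y)%O.
  by move=> [->|[->|[n _ <-]]]; rewrite ?e_min ?lexx ?f_le.
move=> /(_ bnd) fin; apply: infinite_nat.
have : finite_set (range f) by apply: sub_finite_set fin => t ft; right; right.
by rewrite (eq_finite_set (inj_card_eq (in2W f_inj))).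
Qed.

(** Otherwise dependent choice yields a strictly [r]-monotone sequence, which
    is an infinite chain below [y]. With [r] either the strict order or its
    converse this gives maximal and minimal elements. *)
Lemma extremal_below (r : rel S) (y : S) (A : set S) :
  irreflexive r -> transitive r ->
  (forall s t, r s t -> (s <= t)%O \/ (t <= s)%O) ->
  (forall t, A t -> (t <= y)%O) -> A !=set0 ->
  exists2 m, A m & forall t, A t -> ~ r m t.
Proof.
move=> r_irr r_tr r_cmp A_le [a Aa]; apply: contrapT => noext.
have next (s : {s | A s}) : {t : {s | A s} | r (sval s) (sval t)}.
  apply: cid; apply: contrapT => no_t; apply: noext; exists (sval s).
    exact: (svalP s).
  by move=> t At rst; apply: no_t; exists (exist _ t At).
have [f [_ fr]] := dependent_choice next (exist _ a Aa).
have f_mono n m : (n < m)%N -> r (sval (f n)) (sval (f m)).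
  elim: m => // m IH; rewrite ltnS leq_eqVlt => /orP[/eqP->//|/IH/r_tr]; exact.
apply: (@no_infinite_chain y (fun n => sval (f n))) => [n m|n m|n].
- by move=> fnm; case: (ltngtP n m) => // /f_mono; rewrite fnm r_irr.
- by case: (ltngtP n m) => [/f_mono/r_cmp[]|/f_mono/r_cmp[]|->]; tauto || left.
- exact: A_le (svalP (f n)).
Qed.

Lemma cover_below (x y : S) : (x < y)%O -> exists2 z, covers z x & (z <= y)%O.
Proof.
move=> xy.
have [||s t /ltW|t [_]//||m [xm my] mmin] :=
  @extremal_below (fun s t => (t < s)%O) y [set t | (x < t)%O /\ (t <= y)%O].
- exact: ltxx.
- by move=> s t u /= ts us; exact: lt_trans us ts.
- by right.
- by exists y.
exists m => //; split=> // t xt; rewrite le_eqVlt => /orP[/eqP//|tm].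
by case: (mmin t) => //; split=> //; exact: le_trans (ltW tm) my.
Qed.

Lemma covers_lt (y x : S) : covers y x -> (x < y)%O.
Proof. by case. Qed.

Lemma covering_path_le (x : S) p : path covering_edge x p -> (x <= last x p)%O.
Proof.
elim: p x => //= z p IH x /andP[/asboolP/covers_lt/ltW xz /IH].
exact: le_trans.
Qed.

(** Take a maximal element below [y] among those reachable from [x]: if it were
    not [y], some element covering it would still lie below [y]. *)
Lemma covering_path_of_le (x y : S) : (x <= y)%O ->
  exists2 p, path covering_edge x p & last x p = y.
Proof.
move=> xy.
have [||s t /ltW|t []//||m [my [p xp lp]] mmax] :=
  @extremal_below (fun s t => (s < t)%O) y
    [set t | (t <= y)%O /\ exists2 p, path covering_edge x p & last x p = t].
- exact: ltxx.
- exact: lt_trans.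
- by left.
- by exists x; split=> //; exists [::].
move: my; rewrite le_eqVlt => /orP[/eqP <-|/cover_below[z zm zy]].
  by exists p.
case: (mmax z); last exact: covers_lt; split=> //; exists (rcons p z).
  by rewrite rcons_path xp lp; exact/asboolP.
by rewrite last_rcons.
Qed.

Definition root_path (x : S) : seq S := xget [::] (covering_paths e x).

Lemma root_pathP x : covering_paths e x (root_path x).
Proof. by have [p [ep _]] := S_tree x; exact: (xgetI _ ep). Qed.

Lemma root_path_uniq x p : covering_paths e x p -> p = root_path x.
Proof.
by have [q [_ q_uniq]] := S_tree x; move=> /q_uniq <-; exact/q_uniq/root_pathP.
Qed.

Lemma root_path_root : root_path e = [::].
Proof. by rewrite -(@root_path_uniq e [::]). Qed.

Lemma root_path_cover w y : covers y w -> root_path y = rcons (root_path w) y.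
Proof.
move=> yw; apply/esym/root_path_uniq; have [ew lw] := root_pathP w.
by split; [rewrite rcons_path ew lw; exact/asboolP|rewrite last_rcons].
Qed.

Lemma covers_root x : ~ covers e x.
Proof. by move=> /covers_lt; rewrite lt_leAnge e_min andbF. Qed.

Lemma parent_covers (y : S) : y != e -> covers y (parent y).
Proof.
move=> ye; suff [w yw] : exists w, lower_covers y w by exact: (xgetI _ yw).
have [ep lp] := root_pathP y.
case/lastP: (root_path y) ep lp => [_ /= ey|p z].
  by rewrite ey eqxx in ye.
rewrite rcons_path last_rcons => /andP[_ /asboolP zp] zy.
by exists (last e p); rewrite -zy.
Qed.

(** A second element covered by [y] would give a second path from [e] to [y]. *)
Lemma covers_parent (y w : S) : covers y w -> w = parent y.
Proof.
move=> yw; have ye : y != e by apply: contraPneq yw => ->; exact: covers_root.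
have := root_path_cover (parent_covers ye); rewrite (root_path_cover yw).
move=> /rcons_inj[wy]; have [_ <-] := root_pathP w; rewrite wy.
by have [_ ->] := root_pathP (parent y).
Qed.

Lemma parent_lt y : y != e -> (parent y < y)%O.
Proof. by move=> /parent_covers/covers_lt. Qed.

Lemma tree_dist_root : tree_dist e e = 0%N.
Proof. by rewrite /tree_dist -/(root_path e) root_path_root. Qed.

Lemma tree_dist_parent y : y != e ->
  tree_dist e y = (tree_dist e (parent y)).+1.
Proof.
move=> /parent_covers/root_path_cover yp.
by rewrite /tree_dist -/(root_path y) yp size_rcons.
Qed.

Lemma tree_dist_eq0 y : tree_dist e y = 0%N -> y = e.
Proof. by have [//|/tree_dist_parent->] := eqVneq y e. Qed.

Lemma tree_ind (P : S -> Prop) :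
  P e -> (forall y, y != e -> P (parent y) -> P y) -> forall y, P y.
Proof.
move=> Pe Pp y; have [n] := ubnP (tree_dist e y); elim: n y => // n IH y.
have [->//|ye] := eqVneq y e.
by rewrite tree_dist_parent// ltnS => /IH; exact: Pp.
Qed.

Lemma le_root x : (x <= e)%O = (x == e).
Proof. by apply/idP/eqP => [xe|->//]; apply/eqP; rewrite eq_le xe e_min. Qed.

(** A covering path from a strictly smaller [x] to [y] must use the only edge
    into [y]. *)
Lemma le_parent x y : y != e -> (x <= y)%O = (x == y) || (x <= parent y)%O.
Proof.
move=> ye; apply/idP/idP => [|/orP[/eqP->//|]]; last first.
  by move=> /le_trans; apply; exact/ltW/parent_lt.
move=> /covering_path_of_le[p]; case/lastP: p => [_ /= ->|p z].
  by rewrite eqxx.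
rewrite rcons_path last_rcons => /andP[xp /asboolP + zy]; rewrite zy.
by move=> /covers_parent <-; rewrite covering_path_le ?orbT.
Qed.

Lemma lt_parent x y : (x < y)%O <-> y != e /\ (x <= parent y)%O.
Proof.
split=> [xy|[ye xp]]; last exact: le_lt_trans xp (parent_lt ye).
have ye : y != e by rewrite gt_eqF// (le_lt_trans (e_min x)).
by move: (ltW xy); rewrite le_parent// (lt_eqF xy).
Qed.

Lemma lt_cover (y z : S) : (y < z)%O <-> exists2 c, covers c y & (c <= z)%O.
Proof.
split=> [/cover_below//|[c cy cz]]; exact: lt_le_trans (covers_lt cy) cz.
Qed.

(** Two distinct elements covering [y] are incomparable, whereas the elements
    below [z] form a chain. *)
Lemma siblings_disjoint (y c d z : S) :
  covers c y -> covers d y -> (c <= z)%O -> (d <= z)%O -> c = d.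
Proof.
move=> cy dy; elim/tree_ind: z => [|z ze IH].
  by rewrite !le_root => /eqP-> /eqP.
rewrite !(le_parent _ ze) => /orP[/eqP cz|cz] /orP[/eqP dz|dz]; last exact: IH.
- by rewrite cz.
- by move: (covers_lt dy) => /lt_geF; rewrite (covers_parent cy) cz dz.
- by move: (covers_lt cy) => /lt_geF; rewrite (covers_parent dy) dz cz.
Qed.


Lemma le_root_path x y : (x <= y)%O = (x \in e :: root_path y).
Proof.
elim/tree_ind: y => [|y ye IH]; first by rewrite root_path_root inE le_root.
rewrite le_parent// IH (root_path_cover (parent_covers ye)).
by rewrite -rcons_cons mem_rcons [RHS]inE.
Qed.

Lemma count_ancestors (s : seq S) y : uniq s ->
  (count (fun x => (x <= y)%O) s <= (tree_dist e y).+1)%N.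
Proof.
move=> s_uniq; rewrite -size_filter -[leqRHS]/(size (e :: root_path y)).
apply: uniq_leq_size; first exact: filter_uniq.
by move=> x; rewrite mem_filter le_root_path => /andP[].
Qed.

(** * Summation over up-sets *)

Section UpperProbability.
Context {R : realType}.
Implicit Types (f q : S -> R) (Q : S -> S -> R).

Lemma upper_prob_ge0 f x : (forall x, 0 <= f x) -> (0 <= upper_prob f x)%E.
Proof. by move=> f0; apply: esum_ge0 => y _; rewrite lee_fin. Qed.

Lemma upper_prob_root f : is_pdf f -> upper_prob f e = 1%E.
Proof.
move=> [_ <-]; rewrite /upper_prob; congr esum.
by apply/seteqP; split=> // x _; exact: e_min.
Qed.

Lemma upper_prob_fin_num f x : is_pdf f -> upper_prob f x \is a fin_num.
Proof. exact: esum_pdf_fin_num. Qed.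

Lemma upper_prob_strict f y : (forall x, 0 <= f x) ->
  upper_prob f y =
  ((f y)%:E + \esum_(z in [set z | (y < z)%O]) (f z)%:E)%E.
Proof.
move=> f0; rewrite /upper_prob (esumID [set y]); last first.
  by move=> *; rewrite lee_fin.
rewrite (_ : _ `&` [set y] = [set y]); last first.
  by apply/seteqP; split=> [z []//|z ->]; split=> //=.
rewrite esum_set1 ?lee_fin//; congr (_ + esum _ _)%E.
apply/seteqP; split=> [z [/= yz /eqP zy]|z /= yz].
  by rewrite lt_neqAle yz andbT eq_sym.
by split; [exact: ltW|move=> /= zy; rewrite zy ltxx in yz].
Qed.

(** The strict up-set of [y] is the disjoint union of the up-sets of the
    elements covering [y]. *)
Lemma upper_prob_cover f y : (forall x, 0 <= f x) ->
  upper_prob f y =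
  ((f y)%:E + \esum_(c in [set c | covers c y]) upper_prob f c)%E.
Proof.
move=> f0; rewrite upper_prob_strict// /upper_prob -esum_disjoint_union.
- congr (_ + esum _ _)%E; apply/seteqP; split=> z /=.
    by move=> /lt_cover[c yc cz]; exists c.
  by move=> [c yc cz]; apply/lt_cover; exists c.
- by move=> c d z; exact: siblings_disjoint.
- by move=> z; rewrite lee_fin.
Qed.

(** * Invariant densities of a downward run chain *)

Lemma pdf_concentrated f a : is_pdf f -> (forall x, x != a -> f x = 0) ->
  f a = 1.
Proof.
move=> [f0 f1] fa; move: f1; rewrite (esumID [set a]); last first.
  by move=> *; rewrite lee_fin.
rewrite setTI esum_set1 ?lee_fin// esum1 ?adde0 => [[]//|].
by move=> x [_ /= /eqP/fa ->].
Qed.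

Lemma downward_runE Q x y : downward_run e Q -> x != e ->
  Q x y = (y == parent x)%:R.
Proof.
move=> [Qpdf Qpos] xe.
have Q0 z : z != parent x -> Q x z = 0.
  move=> zp; apply/eqP; rewrite eq_le (Qpdf x).1 andbT leNgt.
  apply/negP => /Qpos[/eqP|[_ xz]]; first by rewrite (negPf xe).
  by rewrite (covers_parent xz) eqxx in zp.
by have [->|/Q0//] := eqVneq; exact: pdf_concentrated Q0.
Qed.

Lemma full_support_root Q : downward_run e Q -> full_support (Q e).
Proof. by move=> [_ Qpos] x; apply/Qpos; left. Qed.

(** Only the root and the elements covering [y] can move to [y] in one step. *)
Lemma esum_invariant Q f y : downward_run e Q -> (forall x, 0 <= f x) ->
  \esum_(x in [set: S]) (f x * Q x y)%:E =
  ((f e * Q e y)%:E + \esum_(x in [set x | covers x y]) (f x)%:E)%E.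
Proof.
move=> Qrun f0; have [Qpdf _] := Qrun.
rewrite (esumID [set e]); last first.
  by move=> x _; rewrite lee_fin mulr_ge0// (Qpdf x).1.
rewrite setTI esum_set1; last by rewrite lee_fin mulr_ge0// (Qpdf e).1.
congr (_ + _)%E; rewrite esum_mkcond [RHS]esum_mkcond; apply: eq_esum => x _.
rewrite setTI in_setC; have [->|xe] := eqVneq x e.
  by rewrite mem_set//= memNset//; exact: covers_root.
rewrite (@memNset _ [set e])/=; last exact/eqP.
rewrite downward_runE//; case: ifPn => [|].
  by rewrite inE => /= /covers_parent ->; rewrite eqxx mulr1.
rewrite notin_setE /= => nxy; case: eqP => [yp|_]; last by rewrite mulr0.
by case: nxy; rewrite yp; exact: parent_covers.
Qed.

(** Summing the invariance equation over the up-set of [y], both sides contain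
    the finite sum of [f] over the elements strictly above [y]. *)
Lemma invariant_pdfE Q f y : downward_run e Q -> invariant_pdf Q f ->
  (f y)%:E = ((f e)%:E * upper_prob (Q e) y)%E.
Proof.
move=> Qrun [fpdf finv]; have [f0 _] := fpdf; have [Qpdf _] := Qrun.
have Qe0 := (Qpdf e).1.
pose T := \esum_(z in [set z | (y < z)%O]) (f z)%:E.
suff : ((f y)%:E + T = (f e)%:E * upper_prob (Q e) y + T)%E.
  have T_fin : T \is a fin_num by exact: esum_pdf_fin_num.
  by move=> /(congr1 (fun z => (z - T)%E)); rewrite !addeK.
rewrite -upper_prob_strict//.
under [LHS]eq_esum do rewrite -finv esum_invariant//.
rewrite esumD; last 2 first.
- by move=> *; rewrite lee_fin mulr_ge0.
- by move=> *; apply: esum_ge0 => *; rewrite lee_fin.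
under eq_esum do rewrite EFinM.
rewrite ge0_esumZl//; congr (_ + _)%E.
rewrite -esum_disjoint_union; last 2 first.
- by move=> i i' j _ _ /= /covers_parent-> /covers_parent->.
- by move=> *; rewrite lee_fin.
congr esum; apply/seteqP; split=> z /=.
  by move=> [w yw zw]; exact: le_lt_trans yw (covers_lt zw).
by move=> /lt_parent[ze yz]; exists (parent z) => //; exact: parent_covers.
Qed.

(** As [upper_prob (Q e)] is [1] at the root, the recursion [upper_prob_cover]
    is literally the invariance equation of this function. *)
Lemma invariant_pdf_upper Q m : downward_run e Q ->
  \esum_(x in [set: S]) upper_prob (Q e) x = m%:E -> 0 < m ->
  invariant_pdf Q (fun x => fine (upper_prob (Q e) x) / m).
Proof.
move=> Qrun sumG m0; have [Qpdf _] := Qrun; have Qe0 := (Qpdf e).1.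
have GE x : (fine (upper_prob (Q e) x))%:E = upper_prob (Q e) x.
  by rewrite fineK// upper_prob_fin_num.
have f0 x : 0 <= fine (upper_prob (Q e) x) / m.
  by rewrite divr_ge0 ?(ltW m0)// fine_ge0// upper_prob_ge0.
have fE x : (fine (upper_prob (Q e) x) / m)%:E =
    ((m^-1)%:E * upper_prob (Q e) x)%E by rewrite mulrC EFinM GE.
have m'0 : 0 <= m^-1 by rewrite invr_ge0 ltW.
split; first split=> //.
  under eq_esum do rewrite fE.
  rewrite ge0_esumZl//; last by move=> x; exact: upper_prob_ge0.
  by rewrite sumG -EFinM mulVf ?gt_eqF.
move=> y; rewrite esum_invariant//; under eq_esum do rewrite fE.
rewrite ge0_esumZl//; last by move=> x; exact: upper_prob_ge0.
rewrite EFinM fE upper_prob_root// mule1 -muleDr.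
- by rewrite -upper_prob_cover// -fE.
- by [].
- by rewrite ge0_adde_def// inE ?lee_fin//; apply: esum_ge0 => *;
    exact: upper_prob_ge0.
Qed.

(** By [invariant_pdfE] two invariant densities are proportional, and both have
    total mass [1]. *)
Lemma invariant_pdf_unique Q f f' : downward_run e Q ->
  invariant_pdf Q f -> invariant_pdf Q f' -> f' = f.
Proof.
move=> Qrun finv f'inv; have [Qpdf _] := Qrun; have Qe0 := (Qpdf e).1.
have total_mass h : invariant_pdf Q h ->
    ((h e)%:E * (\esum_(x in [set: S]) upper_prob (Q e) x) = 1)%E.
  move=> hinv; rewrite -ge0_esumZl.
  - rewrite -hinv.1.2; apply: eq_esum => x _.
    by rewrite (invariant_pdfE x Qrun).
  - exact: hinv.1.1.
  - by move=> x; exact: upper_prob_ge0.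
have fe_eq : f' e = f e.
  case: (\esum_(x in [set: S]) _)
    (total_mass f finv) (total_mass f' f'inv) => [M||].
  - rewrite -!EFinM => -[fM] [f'M]; have M0 : M != 0.
      by apply: contra_eq_neq fM => ->; rewrite mulr0 eq_sym oner_neq0.
    by apply: (mulIf M0); rewrite fM.
  - have := finv.1.1 e; rewrite le_eqVlt => /orP[/eqP <-|fe].
      by rewrite mul0e => -[/eqP]; rewrite eq_sym oner_eq0.
    by rewrite gt0_muley ?lte_fin.
  - have := finv.1.1 e; rewrite le_eqVlt => /orP[/eqP <-|fe].
      by rewrite mul0e => -[/eqP]; rewrite eq_sym oner_eq0.
    by rewrite gt0_muleNy ?lte_fin.
apply/funext => y; apply/EFin_inj.
by rewrite (invariant_pdfE y Qrun finv) (invariant_pdfE y Qrun f'inv) fe_eq.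
Qed.

(** Comparing rates at [x] and at [e] shows that [f] and [q] have the same upper
    probability function as soon as the rate of [f] is constant. An upper
    probability function determines its density, since its value at [x] exceeds
    the sum of its values at the elements covering [x] by the density at [x]. *)
Lemma constant_rateP f q : is_pdf f -> is_pdf q -> full_support q ->
  (forall x, (f x)%:E = ((f e)%:E * upper_prob q x)%E) ->
  (forall x, f x = q x) <-> constant_rate f.
Proof.
move=> fpdf qpdf q_supp fE; have [f0 _] := fpdf; have [q0 _] := qpdf.
have qE x : (fine (upper_prob q x))%:E = upper_prob q x.
  by rewrite fineK// upper_prob_fin_num.
have uE x : (fine (upper_prob f x))%:E = upper_prob f x.
  by rewrite fineK// upper_prob_fin_num.
have {}fE x : f x = f e * fine (upper_prob q x).
  by apply/EFin_inj; rewrite fE EFinM qE.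
have q_gt0 x : 0 < fine (upper_prob q x).
  rewrite -lte_fin qE upper_prob_strict// (@lt_le_trans _ _ (q x)%:E)//.
    by rewrite lte_fin.
  by rewrite leeDl// esum_ge0// => *; rewrite lee_fin.
split=> [/funext fq|[alpha f_rate]].
  by exists (f e) => x; rewrite /rate fq -[in LHS]fq fE fq mulfK ?gt_eqF.
have {}f_rate x : rate f x = f e.
  by rewrite f_rate -(f_rate e) /rate upper_prob_root// divr1.
have fe0 : f e != 0.
  apply/eqP => fe0; have := fpdf.2; rewrite esum1 => [[/eqP]|x _].
    by rewrite eq_sym oner_eq0.
  by rewrite fE fe0 mul0r.
have fq x : upper_prob f x = upper_prob q x.
  rewrite -uE -qE; congr EFin; have := f_rate x; rewrite /rate.
  have [->|u0] := eqVneq (fine (upper_prob f x)) 0.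
    by rewrite invr0 mulr0 => /esym/eqP; rewrite (negPf fe0).
  by move=> /(canRL (divfK u0)); rewrite fE => /(mulfI fe0).
move=> x; apply/EFin_inj; have := fq x.
rewrite !upper_prob_cover//; under eq_esum do rewrite fq.
have : upper_prob q x \is a fin_num by exact: upper_prob_fin_num.
rewrite upper_prob_cover// fin_numD => /andP[_ T_fin].
by move=> /(congr1 (fun z => z - \esum_(c in [set c | covers c x])
  upper_prob q c)%E); rewrite !addeK.
Qed.

End UpperProbability.

(** * Trajectories descending to the root *)

Definition descends (v : nat -> S) : Prop :=
  forall n, v n != e -> v n.+1 = parent (v n).

Lemma descends_dist v k : descends v -> (k <= tree_dist e (v 0%N))%N ->
  tree_dist e (v k) = (tree_dist e (v 0%N) - k)%N.
Proof.
move=> v_desc; elim: k => [_|k IH ltk]; first by rewrite subn0.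
have vk := IH (ltnW ltk); have vke : v k != e.
  by apply: contraTneq ltk => vke; move: vk; rewrite vke tree_dist_root; lia.
by move: vk; rewrite tree_dist_parent// -v_desc//; lia.
Qed.

Lemma descends_root v : descends v -> v (tree_dist e (v 0%N)) = e.
Proof.
by move=> v_desc; apply: tree_dist_eq0; rewrite descends_dist// subnn.
Qed.

Lemma descends_neq_root v k : descends v -> (k < tree_dist e (v 0%N))%N ->
  v k != e.
Proof.
move=> v_desc ltk; apply/eqP => /(congr1 (tree_dist e)).
by rewrite descends_dist ?tree_dist_root//; lia.
Qed.

(** By [le_parent], each step removes the greatest element of the chain of
    elements below the current position. *)
Lemma descends_visits v x : descends v ->
  (x <= v 0%N)%O <-> exists2 k, (k <= tree_dist e (v 0%N))%N & v k = x.
Proof.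
have [n] := ubnP (tree_dist e (v 0%N)); elim: n v => // n IH v.
rewrite ltnS => vn v_desc; have [v0|v0] := eqVneq (v 0%N) e.
  rewrite v0 tree_dist_root le_root; split=> [/eqP->|[k]]; first by exists 0%N.
  by rewrite leqn0 => /eqP->; rewrite v0 => <-.
have v1 := v_desc 0%N v0; rewrite le_parent// tree_dist_parent// -v1.
rewrite tree_dist_parent// -v1 in vn.
have := IH (fun k => v k.+1) vn (fun k => v_desc k.+1); rewrite /= => {}IH.
split=> [/orP[/eqP->|/IH[k lek vk]]|[[|k] lek vk]]; first by exists 0%N.
- by exists k.+1.
- by rewrite vk eqxx.
- by apply/orP; right; apply/IH; exists k.
Qed.

(** * Return times of a downward run chain *)

Section MarkovChain.
Hypothesis S_countable : countable [set: S].
Context {R : realType} {d : measure_display} {Omega : measurableType d}.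
Variables (Q : S -> S -> R) (P : S -> probability Omega R).
Variable Y : nat -> Omega -> S.

Lemma hitting_time_le x w n : (1 <= n)%N -> Y n w = x ->
  (hitting_time (R := R) Y x w <= n%:R%:E)%E.
Proof. by move=> n1 Yn; apply: ereal_inf_lbound; exists n. Qed.

Lemma hitting_time_ge x w n :
  (forall m, (1 <= m)%N -> Y m w = x -> (n <= m)%N) ->
  (n%:R%:E <= hitting_time (R := R) Y x w)%E.
Proof.
move=> n_le; apply: le_ereal_inf_tmp => _ [m [m1 Ym] <-].
by rewrite lee_fin ler_nat n_le.
Qed.

Lemma hitting_time_root w : descends (fun n => Y n.+1 w) ->
  hitting_time Y e w = (1 + (tree_dist e (Y 1%N w))%:R%:E :> \bar R)%E.
Proof.
move=> Y_desc; rewrite -EFinD nat1r.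
apply/eqP; rewrite eq_le hitting_time_le//=; last exact: (descends_root Y_desc).
apply: hitting_time_ge => -[//|m] _ Ym; rewrite ltnS leqNgt.
by apply/negP => /(descends_neq_root Y_desc); rewrite Ym eqxx.
Qed.

(** If [x] is not on the way to the root, it is hit strictly after the root or
    never. *)
Lemma hitting_time_before_root w x : descends (fun n => Y n.+1 w) ->
  (hitting_time (R := R) Y x w <= hitting_time Y e w)%E <-> (x <= Y 1%N w)%O.
Proof.
move=> Y_desc; rewrite hitting_time_root// -EFinD nat1r.
rewrite (descends_visits x Y_desc); split=> [|[k lek Yk]]; last first.
  have := hitting_time_le (isT : (1 <= k.+1)%N) Yk => /le_trans; apply.
  by rewrite lee_fin ler_nat.
apply: contraPP => no_visit; apply/negP; rewrite -ltNge.
apply: (@lt_le_trans _ _ ((tree_dist e (Y 1%N w)).+2%:R%:E)).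
  by rewrite lte_fin ltr_nat.
apply: hitting_time_ge => -[//|m] _ Ym; rewrite !ltnS ltnNge; apply/negP => lem.
by apply: no_visit; exists m.
Qed.

Hypothesis Y_chain : markov_chain Q P Y.

Lemma measurable_state n (A : set S) : measurable (Y n @^-1` A).
Proof.
have [mY _ _] := Y_chain.
have [code [decode codeK]] := countable_decode e S_countable.
rewrite (_ : Y n @^-1` A =
    \bigcup_(k in decode @^-1` A) Y n @^-1` [set decode k]).
  by apply: bigcup_measurable => k _; exact: mY.
apply/seteqP; split=> [w Aw|w [k Ak /= ->]//].
by exists (code (Y n w)); rewrite /= codeK.
Qed.

Lemma measurable_history n (s : nat -> S) :
  measurable [set w | forall i, (i <= n)%N -> Y i w = s i].
Proof.
rewrite (_ : [set w | _] =
    \bigcap_(i in [set i | (i <= n)%N]) Y i @^-1` [set s i]).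
  by apply: bigcap_measurableType => i _; exact: measurable_state.
by apply/seteqP; split.
Qed.

Lemma ae_start x : {ae P x, forall w, Y 0%N w = x}.
Proof.
have [_ Y0 _] := Y_chain.
have mY0 : measurable [set w | Y 0%N w = x].
  exact: (measurable_state 0 [set x]).
exists (~` [set w | Y 0%N w = x]); split=> //; first exact: measurableC.
by rewrite probability_setC// Y0 subee.
Qed.

(** Each finite history with an impossible last step has probability zero, and
    there are countably many of them. *)
Lemma ae_step x n : is_transition Q ->
  {ae P x, forall w, 0 < Q (Y n w) (Y n.+1 w)}.
Proof.
move=> Qtr; have [_ _ Ymarkov] := Y_chain.
have [hist histP] := countable_histories e S_countable.
apply: (@negligibleS _ _ _ _ (\bigcup_k
  if 0 < Q (hist k n) (hist k n.+1) then set0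
  else [set w | forall i, (i <= n.+1)%N -> Y i w = hist k i])).
  move=> w /= Qw; have [k kY] := histP (Y^~ w) n.+1; exists k => //.
  by rewrite !kY//; case: ifPn => // _ i lei; rewrite kY.
apply: negligible_bigcup => k; case: ifPn => [_|Qk].
  exact: negligible_set0.
apply/negligibleP; first exact: measurable_history.
rewrite [LHS](Ymarkov x n (hist k)) (_ : Q _ _ = 0) ?mule0//.
by apply/eqP; rewrite eq_le (Qtr _).1 andbT leNgt.
Qed.

Lemma ae_descends : downward_run e Q ->
  {ae P e, forall w, descends (fun n => Y n.+1 w)}.
Proof.
move=> [Qtr Qpos]; have : \forall w \ae P e, forall n, 0 < Q (Y n w) (Y n.+1 w).
  by apply: ae_foralln => n; exact: ae_step.
apply: filterS => w Qw n Yn; have /Qpos[Ye|[_ /covers_parent]//] := Qw n.+1.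
by rewrite Ye eqxx in Yn.
Qed.

Lemma ae_measure_eq (mu : probability Omega R) (A B : set Omega) :
  measurable A -> measurable B -> {ae mu, forall w, A w <-> B w} -> mu A = mu B.
Proof.
have half (C D : set Omega) : measurable C -> measurable D ->
    {ae mu, forall w, C w <-> D w} -> mu C = mu (C `&` D).
  move=> mC mD CD; rewrite (measureDI mu mC mD) -[RHS]add0e; congr (_ + _)%E.
  apply: measure_negligible; first exact: measurableD.
  by apply: negligibleS CD => w [Cw nDw] /= [/(_ Cw)].
move=> mA mB AB; rewrite (half _ _ mA mB AB) setIC -half//.
by apply: filterS AB => w [].
Qed.

Lemma first_step_law x y : P x [set w | Y 1%N w = y] = (Q x y)%:E.
Proof.
have [_ Y0 Ymarkov] := Y_chain.
have := Ymarkov x 0%N (fun i => if i is 0%N then x else y).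
rewrite /= (_ : [set w | forall i, (i <= 0)%N -> _] = [set w | Y 0%N w = x]).
  rewrite Y0 mul1e => <-; apply: ae_measure_eq.
  - exact: (measurable_state 1 [set y]).
  - exact: measurable_history.
  apply: filterS (ae_start x) => w Y0w; split=> [Yw|]; last exact.
  by move=> [|[|i]].
apply/seteqP; split=> w /= => [|Yw [|i]//]; exact.
Qed.

Lemma first_step_set x (A : set S) : (forall y, 0 <= Q x y) ->
  P x [set w | A (Y 1%N w)] = \esum_(y in A) (Q x y)%:E.
Proof.
move=> Q0; have [code [decode codeK]] := countable_decode e S_countable.
rewrite (_ : [set w | _] =
    \bigcup_(k in code @` A) [set w | Y 1%N w = decode k]).
  rewrite measure_bigcup//.
  - rewrite nneseries_esum// (_ : [set k | _] = code @` A).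
      rewrite esum_image; last by apply: in2W; exact: can_inj codeK.
      by apply: eq_esum => y _; rewrite codeK; exact: first_step_law.
    by apply/seteqP; split=> k /=; rewrite inE.
  - by move=> k _; exact: (measurable_state 1 [set decode k]).
  - by move=> _ _ [y _ <-] [z _ <-] [w [/= -> /[!codeK] ->]].
apply/seteqP; split=> [w Aw|w [_ [y Ay <-] /=]]; last by rewrite codeK => ->.
by exists (code (Y 1%N w)); [exists (Y 1%N w)|rewrite /= codeK].
Qed.

Lemma measurable_fun_state n (h : S -> \bar R) :
  measurable_fun setT (fun w => h (Y n w)).
Proof.
by move=> _ B _; rewrite setTI; exact: (measurable_state n (h @^-1` B)).
Qed.

(** The hitting time is an infimum of countably many functions of the states. *)
Lemma measurable_hitting_time x :
  measurable_fun setT (hitting_time (R := R) Y x).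
Proof.
pose f n w : \bar R := if Y n w == x then n%:R%:E else +oo%E.
rewrite (_ : hitting_time Y x = fun w => einfs (f ^~ w) 1%N).
  apply: measurable_fun_einfs => n.
  exact: (measurable_fun_state n (fun y => if y == x then n%:R%:E else +oo%E)).
apply/funext => w; apply/eqP; rewrite eq_le; apply/andP; split.
  apply: le_ereal_inf_tmp => _ [n /= n1 <-]; rewrite /f; case: eqP => [Yn|_].
    exact: hitting_time_le.
  by rewrite leey.
apply: le_ereal_inf_tmp => _ [n [n1 Yn] <-].
by apply: ereal_inf_lbound; exists n => //; rewrite /f Yn eqxx.
Qed.

Section DownwardRun.
Hypothesis Q_run : downward_run e Q.

Lemma std_invariant_upper_law x :
  std_invariant P Y e x = P e [set w | (x <= Y 1%N w)%O].
Proof.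
apply: ae_measure_eq.
- rewrite -[X in measurable X]setTI.
  by apply: measurable_lee => //; exact: measurable_hitting_time.
- exact: (measurable_state 1 [set y | (x <= y)%O]).
by apply: filterS (ae_descends Q_run) => w /(hitting_time_before_root x).
Qed.

Lemma std_invariantE x : std_invariant P Y e x = upper_prob (Q e) x.
Proof.
have [Qpdf _] := Q_run; rewrite std_invariant_upper_law.
by rewrite (first_step_set [set y | (x <= y)%O])// => y; exact: (Qpdf e).1.
Qed.

Lemma hitting_time_ge0 x w : (0 <= hitting_time (R := R) Y x w)%E.
Proof. by apply: le_ereal_inf_tmp => _ [n _ <-]; rewrite lee_fin. Qed.

Lemma expected_return_integral : expected_hitting P Y e e =
  (\int[P e]_w (1 + (tree_dist e (Y 1%N w))%:R%:E))%E.
Proof.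
apply: ge0_ae_eq_integral => //.
- exact: measurable_hitting_time.
- exact: (measurable_fun_state 1 (fun y => 1 + (tree_dist e y)%:R%:E)%E).
- by move=> w _; exact: hitting_time_ge0.
- by move=> w _; rewrite -EFinD lee_fin addr_ge0.
- apply: filterS (ae_descends Q_run) => w Y_desc _.
  exact: hitting_time_root.
Qed.

Lemma expected_return_root : expected_hitting P Y e e =
  (1 + \int[P e]_w ((tree_dist e (Y 1%N w))%:R)%:E)%E.
Proof.
rewrite expected_return_integral ge0_integralD//; last first.
  exact: (measurable_fun_state 1 (fun y => (tree_dist e y)%:R%:E)).
rewrite integral_cst// mul1e; congr (_ + _)%E; exact: probability_setT.
Qed.

(** Each finite partial sum is the expected number of its terms lying below
    [Y 1], and an element has [1 + tree_dist] ancestors, itself included. *)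
Lemma sum_upper_prob_le :
  (\esum_(x in [set: S]) upper_prob (Q e) x <= expected_hitting P Y e e)%E.
Proof.
apply: ge_ereal_sup => _ [X [finX _] <-].
pose below x w : \bar R := (x <= Y 1%N w)%O%:R%:E.
have m_below x : measurable_fun setT (below x).
  exact: (measurable_fun_state 1 (fun y => (x <= y)%O%:R%:E)).
have -> : (\sum_(x \in X) upper_prob (Q e) x =
    \int[P e]_w \sum_(x \in X) below x w)%E.
  rewrite ge0_integral_fsum//; last by move=> x w _; rewrite lee_fin.
  apply: eq_fsbigr => x _; rewrite -std_invariantE std_invariant_upper_law.
  rewrite -[[set w | _]]setIT -(integral_indic (P e))//; last first.
    exact: (measurable_state 1 [set y | (x <= y)%O]).
  by apply: eq_integral => w _; rewrite /below indicE; congr (_%:R%:E);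
    congr nat_of_bool; apply/idP/idP; rewrite inE.
rewrite expected_return_integral.
apply: ge0_le_integral => //.
- by move=> w _; apply: fsume_ge0 => x _; rewrite lee_fin.
- exact: (measurable_fun_state 1
    (fun y => \sum_(x \in X) (x <= y)%O%:R%:E : \bar R)%E).
- exact: (measurable_fun_state 1 (fun y => 1 + (tree_dist e y)%:R%:E)%E).
move=> w _; rewrite fsbig_finite//= /below sumEFin -EFinD nat1r lee_fin.
rewrite -natr_sum ler_nat -big_mkcond/= sum1_count.
exact: count_ancestors (finmap.fset_uniq _).
Qed.

Lemma invariant_pdf_of_recurrent : positive_recurrent P Y ->
  exists f : S -> R,
    [/\ invariant_pdf Q f,
        forall f' : S -> R, invariant_pdf Q f' -> f' = f &
        (forall x, (f x)%:E = P e [set w | Y 1%N w = x]) <-> constant_rate f].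
Proof.
move=> rec; have [Qpdf _] := Q_run; have Qe0 := (Qpdf e).1.
pose m := fine (\esum_(x in [set: S]) upper_prob (Q e) x).
have G0 x : (0 <= upper_prob (Q e) x)%E by exact: upper_prob_ge0.
have mE : \esum_(x in [set: S]) upper_prob (Q e) x = m%:E.
  rewrite fineK// ge0_fin_numE; last by apply: esum_ge0 => x _; exact: G0.
  exact: le_lt_trans sum_upper_prob_le (rec e).
have m0 : 0 < m.
  apply: lt_le_trans ltr01 _; rewrite -lee_fin -mE -(upper_prob_root (Qpdf e)).
  rewrite -[leLHS](esum_set1 (T := S))//.
  exact: subset_esum.
have finv := invariant_pdf_upper Q_run mE m0.
eexists; split; first exact: finv.
  by move=> f' f'inv; exact: invariant_pdf_unique Q_run finv f'inv.
rewrite -(constant_rateP finv.1 (Qpdf e) (full_support_root Q_run)); last first.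
  by move=> x; exact: invariant_pdfE Q_run finv.
split=> fQ x; last by rewrite fQ; exact/esym/first_step_law.
by apply/EFin_inj; rewrite fQ; exact: first_step_law.
Qed.

End DownwardRun.
End MarkovChain.

Lemma run_transition_root {R : realType} (g : S -> R) :
  run_transition e g e = g.
Proof. by apply/funext => y; rewrite /run_transition eqxx. Qed.

Lemma run_transition_run {R : realType} (g : S -> R) : is_pdf g ->
  full_support g -> downward_run e (run_transition e g).
Proof.
move=> gpdf g_supp; split=> [x|x y].
  have [->|/negPf xe] := eqVneq x e; first by rewrite run_transition_root.
  have Q0 y : 0 <= run_transition e g x y.
    by rewrite /run_transition xe; case: ifP.
  split=> //; rewrite (esumID [set parent x]); last first.
    by move=> y _; rewrite lee_fin.
  rewrite setTI esum_set1 ?lee_fin// esum1 ?adde0.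
    by rewrite /run_transition xe eqxx.
  by move=> y [_ /eqP/negPf yx]; rewrite /run_transition xe yx.
rewrite /run_transition; have [->|xe] := eqVneq x e.
  by split=> // _; left.
have [->|yx] := eqVneq y (parent x); rewrite ?ltr01 ?ltxx; split=> //.
- by move=> _; right; split; [exact/eqP|exact: parent_covers].
- by move=> [/eqP|[_ /covers_parent/eqP]]; rewrite ?(negPf xe) ?(negPf yx).
Qed.

End RootedTree.


(** * The uniform distribution on the half-open unit interval *)

Section UnitUniform.
Context {R : realType}.

(** The right endpoint is left out because slots are closed on the left only:
    they partition the half-open interval. *)
Definition unit_uniform : set (measurableTypeR R) -> \bar R :=
  mrestr lebesgue_measure
    (measurable_itv `[0, 1[ :
      measurable (`[0, 1[%classic : set (measurableTypeR R))).

HB.instance Definition _ := Measure.on unit_uniform.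

Let unit_uniform_setT : unit_uniform setT = 1%E.
Proof.
rewrite /unit_uniform /mrestr setTI lebesgue_measure_itv/= lte_fin ltr01.
by rewrite oppr0 adde0.
Qed.

HB.instance Definition _ :=
  Measure_isProbability.Build _ _ R unit_uniform unit_uniform_setT.

Definition pair_with (k : nat) (u : measurableTypeR R) :
  (nat * measurableTypeR R)%type := (k, u).

Let measurable_pair_with k : measurable_fun setT (pair_with k).
Proof. by apply: measurable_fun_pair. Qed.

HB.instance Definition _ k :=
  isMeasurableFun.Build _ _ _ _ (pair_with k) (measurable_pair_with k).

(** Trajectories are only controlled for numbers in the unit interval; clipping
    makes them well behaved on the whole sample space without affecting their
    law. *)
Definition clip (u : R) : R := if 0 <= u < 1 then u else 0.

Lemma clip_itv u : 0 <= clip u < 1.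
Proof. by rewrite /clip; case: ifP => // _; rewrite lexx ltr01. Qed.

Lemma measurable_clip :
  measurable_fun setT (clip : measurableTypeR R -> measurableTypeR R).
Proof.
apply: measurable_fun_ifT => //; apply: (measurable_fun_bool true).
rewrite setTI (_ : _ @^-1` _ = `[0, 1[%classic); first exact: measurable_itv.
by apply/seteqP; split=> u /=; rewrite in_itv.
Qed.

Lemma unit_uniform_clip_itv (a b : R) : 0 <= a -> a <= b -> b <= 1 ->
  unit_uniform [set u | a <= clip u < b] = (b - a)%:E.
Proof.
move=> a0 ab b1; rewrite /unit_uniform /mrestr.
rewrite (_ : _ `&` _ = `[a, b[%classic).
  rewrite lebesgue_measure_itv/= lte_fin; case: ltP => [_|ba].
    by rewrite EFinB.
  by rewrite (@le_anti _ _ a b) ?ab// subrr.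
apply/seteqP; split=> u /=; rewrite !in_itv/= /clip.
  by move=> [+ u01]; rewrite ifT.
move=> /andP[au ub]; have u01 : 0 <= u < 1.
  by rewrite (le_trans a0 au) (lt_le_trans ub b1).
by rewrite ifT// au.
Qed.

End UnitUniform.

(** * Existence of Markov chains on a countable state space *)

Section Existence.
Context {R : realType} {disp : Order.disp_t} {S : porderType disp}.
Variable code : S -> nat.
Hypothesis code_inj : injective code.

Section Slots.
Variable q : S -> R.
Hypothesis q_pdf : is_pdf q.

(** The distribution function of the image of [q] under [code], strict in [n]
    so that the slot of [y] starts at [cumul (code y)]. *)
Definition cumul (n : nat) : R :=
  fine (\esum_(z in [set z | (code z < n)%N]) (q z)%:E).

Let q_ge0 x : (0 <= (q x)%:E)%E.
Proof. by rewrite lee_fin; exact: q_pdf.1. Qed.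

Let cumulE n :
  (cumul n)%:E = (\esum_(z in [set z | (code z < n)%N]) (q z)%:E).
Proof. by rewrite fineK// esum_pdf_fin_num. Qed.

Lemma cumul_ge0 n : 0 <= cumul n.
Proof. by rewrite -lee_fin cumulE esum_ge0. Qed.

Lemma cumul_le1 n : cumul n <= 1.
Proof. by rewrite -lee_fin cumulE -q_pdf.2; exact: subset_esum. Qed.

Lemma le_cumul m n : (m <= n)%N -> cumul m <= cumul n.
Proof.
move=> mn; rewrite -lee_fin !cumulE; apply: subset_esum => // z /= zm.
exact: leq_trans zm mn.
Qed.

Lemma cumulS y : cumul (code y).+1 = cumul (code y) + q y.
Proof.
apply/EFin_inj; rewrite EFinD !cumulE (esumID [set y])// addeC.
rewrite (_ : _ `&` [set y] = [set y]); last first.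
  by apply/seteqP; split=> [z []//|z ->]; split=> //=.
rewrite esum_set1//; congr (esum _ _ + _)%E.
apply/seteqP; split=> z /=.
  by move=> []; rewrite ltnS leq_eqVlt => /orP[/eqP/code_inj//|].
by move=> zy; split; [exact: leqW|move=> zy'; rewrite zy' ltnn in zy].
Qed.

Definition slot (y : S) : set R :=
  [set u | cumul (code y) <= u < cumul (code y) + q y].

Lemma slot_inj y z u : slot y u -> slot z u -> y = z.
Proof.
rewrite /slot/= -!cumulS.
have disj a b : (code a < code b)%N ->
    cumul (code a) <= u < cumul (code a).+1 ->
    cumul (code b) <= u < cumul (code b).+1 -> False.
  move=> /le_cumul ab /andP[_ ua] /andP[ub _].
  by have := le_lt_trans (le_trans ab ub) ua; rewrite ltxx.
case: (ltngtP (code y) (code z)) => [/disj h /h //|/disj h ? /h //|].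
by move=> /code_inj.
Qed.

(** The slots cover the unit interval because the partial sums of [q] tend to
    its total mass [1]. *)
Lemma slot_cover u : 0 <= u < 1 -> exists y, slot y u.
Proof.
move=> /andP[u0 u1].
have ex_n : exists n, u < cumul n.
  have : (u%:E < \esum_(z in [set: S]) (q z)%:E)%E by rewrite q_pdf.2 lte_fin.
  move=> /ereal_sup_gt[_ [X [finX _] <-] uX].
  exists (\max_(x <- finmap.enum_fset (fset_set X)) code x).+1.
  rewrite -lte_fin cumulE; apply: lt_le_trans uX _; apply: esum_ge.
  exists X => //; split=> // x Xx; rewrite /= ltnS.
  by apply: leq_bigmax_seq => //; rewrite in_fset_set// inE.
have [n un n_min] := ex_minnP ex_n.
case: n un n_min => [|n] un n_min.
  move: un; rewrite -lte_fin cumulE (_ : [set _ | _] = set0).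
    by rewrite esum_set0 lte_fin ltNge u0.
  by apply/seteqP; split.
have nu : cumul n <= u.
  by rewrite leNgt; apply/negP => /n_min; rewrite ltnn.
have [[y yn]|noy] := pselect (exists y, code y = n).
  by exists y; rewrite /slot/= -cumulS yn nu.
suff cn : cumul n.+1 = cumul n by rewrite cn ltNge nu in un.
apply/EFin_inj; rewrite !cumulE; congr esum; apply/seteqP; split=> z /=.
  rewrite ltnS leq_eqVlt => /orP[/eqP zn|//]; by case: noy; exists z.
by move=> /leqW.
Qed.

End Slots.

Variable Q : S -> S -> R.
Hypothesis Q_tr : is_transition Q.

(** The default value [x] of [xget] is only used outside the unit interval. *)
Definition next_state (x : S) (u : R) : S := xget x (fun y => slot (Q x) y u).

Definition rescale (x y : S) (u : R) : R := (u - cumul (Q x) (code y)) / Q x y.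

(** The trajectory from [x] driven by the single number [u]: the position of
    [u] inside its slot, rescaled, is again uniform and drives the rest. *)
Fixpoint walk (n : nat) (x : S) (u : R) : S :=
  if n is n'.+1 then
    let y := next_state x u in walk n' y (rescale x y u)
  else x.

Lemma next_stateE x y u : slot (Q x) y u -> next_state x u = y.
Proof.
move=> yu; apply: (slot_inj (Q_tr x)) (yu).
exact: (@xgetI _ x (fun z => slot (Q x) z u) _ yu).
Qed.

Lemma next_stateP x u : 0 <= u < 1 -> slot (Q x) (next_state x u) u.
Proof. by move=> /(slot_cover (Q_tr x))[y yu]; rewrite (next_stateE yu). Qed.

(** By induction on the first step: the numbers starting a given history form an
    interval of the slot of its first step, the image of the interval of the
    remaining history under the affine map undoing [rescale]. *)
Lemma walk_history n (s : nat -> S) : exists a : R,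
  [/\ 0 <= a, a + \prod_(i < n) Q (s i) (s i.+1) <= 1 &
  forall u : R, 0 <= u < 1 ->
    (forall i, (i <= n)%N -> walk i (s 0%N) u = s i) <->
    a <= u < a + \prod_(i < n) Q (s i) (s i.+1)].
Proof.
elim: n s => [|n IH] s.
  exists 0; rewrite big_ord0 add0r; split=> // u u01; split=> // _ i.
  by rewrite leqn0 => /eqP->.
have [a [a0 a1 aP]] := IH (fun i => s i.+1).
rewrite big_ord_recl/=; set p := \prod_(i < n) _ in a1 aP *.
have p0 : 0 <= p by apply: prodr_ge0 => i _; exact: (Q_tr _).1.
set q := Q (s 0%N) (s 1%N); set c := cumul (Q (s 0%N)) (code (s 1%N)).
have hist u : (forall i, (i <= n.+1)%N -> walk i (s 0%N) u = s i) <->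
    next_state (s 0%N) u = s 1%N /\
    (forall i, (i <= n)%N -> walk i (s 1%N) ((u - c) / q) = s i.+1).
  split=> [h|[h1 h] [|i]//=]; last by rewrite h1; exact: h.
  have h1 := h 1%N isT; rewrite /= in h1; split=> // i /(h i.+1) /=.
  by rewrite h1.
have q0 : 0 <= q by exact: (Q_tr _).1.
have cq1 : c + q <= 1.
  by rewrite -(cumulS (Q_tr _)); exact: (cumul_le1 (Q_tr _)).
have c0 : 0 <= c by exact: (cumul_ge0 (Q_tr _)).
(* A step of probability zero has an empty slot, so no number starts it. *)
move: q0; rewrite le_eqVlt => /orP[/eqP q0|q0].
  exists 0; split=> //; first by rewrite -q0 mul0r addr0.
  move=> u u01; rewrite hist -q0 mul0r addr0.
  split=> [[h1 _]|u0]; last by exfalso; lra.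
  by have := next_stateP (s 0%N) u01; rewrite h1 /slot/= -/q -q0 -/c;
    clear h1; lra.
have bound : a * q <= q /\ (a + p) * q <= q.
  by split; rewrite -[leRHS]mul1r ler_wpM2r ?(ltW q0)//; lra.
exists (c + a * q); split; [by nra|by nra|move=> u u01; rewrite hist].
have rE : (a <= (u - c) / q < a + p) = (c + a * q <= u < c + a * q + q * p).
  rewrite ler_pdivlMr// ltr_pdivrMr// lerBrDl ltrBlDl.
  by rewrite -addrA mulrDl (mulrC p).
split=> [[h1 h]|u_in].
  rewrite -rE; apply/aP => //; have := next_stateP (s 0%N) u01.
  rewrite h1 /slot/= -/c -/q => /andP[cu uq].
  by rewrite divr_ge0 ?subr_ge0 ?(ltW q0)//= ltr_pdivrMr// mul1r ltrBlDl.
have u_slot : slot (Q (s 0%N)) (s 1%N) u.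
  by rewrite /slot/= -/c -/q; move: u_in bound; rewrite mulrDl; nra.
split; first exact: next_stateE.
apply/aP; last by rewrite rE.
move: u_slot; rewrite /slot/= -/c -/q => /andP[cu uq].
by rewrite divr_ge0 ?subr_ge0 ?(ltW q0)//= ltr_pdivrMr// mul1r ltrBlDl.
Qed.

Lemma walk_history_clip n (s : nat -> S) : exists a : R,
  [/\ 0 <= a, a + \prod_(i < n) Q (s i) (s i.+1) <= 1 &
  [set u | forall i, (i <= n)%N -> walk i (s 0%N) (clip u) = s i] =
  [set u | a <= clip u < a + \prod_(i < n) Q (s i) (s i.+1)]].
Proof.
have [a [a0 a1 aP]] := walk_history n s; exists a; split=> //.
by apply/seteqP; split=> u /=; move/(aP _ (clip_itv u)).
Qed.

(** A countable union, over the histories from [x] to [y], of preimages of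
    intervals under [clip]. *)
Lemma measurable_walk n x y :
  measurable [set u : measurableTypeR R | walk n x (clip u) = y].
Proof.
have S_countable : countable [set: S].
  by apply/countable_injP; exists code; exact: in2W.
have [hist histP] := countable_histories x S_countable.
rewrite (_ : [set u | _] =
  \bigcup_(k in [set k | hist k 0%N = x /\ hist k n = y])
    [set u : measurableTypeR R |
      forall i, (i <= n)%N -> walk i (hist k 0%N) (clip u) = hist k i]).
  apply: bigcup_measurable => k _.
  have [a [_ _ ->]] := walk_history_clip n (hist k).
  rewrite -[X in measurable X]setTI.
  set b := a + _; have := measurable_clip measurableT (measurable_itv `[a, b[).
  by rewrite (_ : _ @^-1` _ = [set u | a <= clip u < b]).
apply/seteqP; split=> [u /= uy|u [k /= [kx ky] /(_ n (leqnn n))]].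
  have [k kP] := histP (fun i => walk i x (clip u)) n.
  exists k => /=; first by rewrite !kP.
  by move=> i lei; rewrite !kP.
by rewrite kx ky.
Qed.

End Existence.

(** The sample space records the code of the initial state next to the uniform
    number, so that one process serves all initial states. *)
Lemma markov_chain_exists {R : realType} {disp : Order.disp_t}
    {S : porderType disp} (e : S) (Q : S -> S -> R) :
  countable [set: S] -> is_transition Q ->
  exists (d : measure_display) (Omega : measurableType d)
    (P : S -> probability Omega R) (Y : nat -> Omega -> S), markov_chain Q P Y.
Proof.
move=> S_countable Q_tr.
have [code [decode codeK]] := countable_decode e S_countable.
have code_inj := can_inj codeK.
exists _, (nat * measurableTypeR R)%type.
exists (fun x => distribution unit_uniform (pair_with (code x))).
pose Y n (w : nat * measurableTypeR R) := walk code Q n (decode w.1) (clip w.2).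
exists Y.
have mY n y : measurable (Y n @^-1` [set y]).
  rewrite (_ : Y n @^-1` [set y] = \bigcup_k ([set k] `*`
      [set u : measurableTypeR R | walk code Q n (decode k) (clip u) = y])).
    apply: bigcupT_measurable => k; apply: measurableX => //.
    exact: measurable_walk.
  by apply/seteqP; split=> [[k u] uy|[k u] [_ _ [/= ->]]//]; exists k.
have history x n (s : nat -> S) :
    distribution unit_uniform (pair_with (code x))
      [set w | forall i, (i <= n)%N -> Y i w = s i] =
    (if x == s 0%N then \prod_(i < n) Q (s i) (s i.+1) else 0)%:E.
  rewrite /distribution /pushforward.
  case: eqP => [->|xs]; last first.
    rewrite (_ : _ @^-1` _ = set0) ?measure0//.
    by apply/seteqP; split=> // u /(_ 0%N isT); rewrite /Y/= codeK.
  have [a [a0 a1 aE]] := walk_history_clip code_inj Q_tr n s.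
  rewrite (_ : _ @^-1` _ =
      [set u | a <= clip u < a + \prod_(i < n) Q (s i) (s i.+1)]).
    apply: etrans (unit_uniform_clip_itv a0 _ a1) _.
      by rewrite lerDl prodr_ge0// => i _; exact: (Q_tr _).1.
    by rewrite addrC addKr.
  by rewrite -aE /Y; apply/seteqP; split=> u /=; rewrite codeK.
split=> // [x|x n s].
  have := history x 0%N (fun=> x); rewrite eqxx big_ord0 => <-.
  congr (distribution _ _ _); apply/seteqP; split=> w /=.
    by move=> Yx i; rewrite leqn0 => /eqP->.
  by move=> /(_ 0%N isT).
rewrite [LHS](history x n.+1 s) [X in (X * _)%E](history x n s).
rewrite big_ord_recr/=; case: eqP => _; first by rewrite EFinM.
by rewrite mul0e.
Qed.
Theorem mainTheorem11 (R : realType) (disp : Order.disp_t) (S : porderType disp)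
    (e : S)
    (S_countable : countable [set: S])
    (e_min : forall x : S, (e <= x)%O)
    (S_chains : locally_finite_from e)
    (S_tree : is_rooted_tree e) :
  (forall (Q : S -> S -> R) (d : measure_display) (Omega : measurableType d)
      (P : S -> probability Omega R) (Y : nat -> Omega -> S),
    downward_run e Q -> markov_chain Q P Y ->
    [/\ forall x, std_invariant P Y e x = upper_prob (Q e) x,
        forall x, std_invariant P Y e x = P e [set w | (x <= Y 1%N w)%O],
        expected_hitting P Y e e =
          (1 + \int[P e]_w ((tree_dist e (Y 1%N w))%:R)%:E)%E &
        positive_recurrent P Y ->
          exists f : S -> R,
            [/\ invariant_pdf Q f,
                forall f' : S -> R, invariant_pdf Q f' -> f' = f &
                (forall x, (f x)%:E = P e [set w | Y 1%N w = x]) <->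
                constant_rate f]])
  /\
  (forall G g : S -> R,
    is_pdf g -> full_support g -> (forall x, (G x)%:E = upper_prob g x) ->
    [/\ downward_run e (run_transition e g),
        exists (d : measure_display) (Omega : measurableType d)
          (P : S -> probability Omega R) (Y : nat -> Omega -> S),
          markov_chain (run_transition e g) P Y &
        forall (d : measure_display) (Omega : measurableType d)
          (P : S -> probability Omega R) (Y : nat -> Omega -> S),
          markov_chain (run_transition e g) P Y ->
          forall x, std_invariant P Y e x = (G x)%:E]).
Proof.
split=> [Q d Omega P Y Q_run Y_chain|G g gpdf g_supp GE].
  split.
  - exact: std_invariantE Y_chain Q_run.
  - exact: std_invariant_upper_law Y_chain Q_run.
  - exact: expected_return_root Y_chain Q_run.
  - exact: invariant_pdf_of_recurrent Y_chain Q_run.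
have g_run : downward_run e (run_transition e g) by exact: run_transition_run.
split=> //.
  by apply: markov_chain_exists e _ S_countable g_run.1.
move=> d Omega P Y Y_chain x; rewrite GE -[in RHS](run_transition_root e g).
exact: std_invariantE Y_chain g_run x.
Qed.
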